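(* Let $\mathcal{E}_{t,\mu}=\{p_\theta:\theta\in\Theta\}$ be a conic exponential family with log-partition function $F$. Let $n\ge 1$, let $p_1=p_{\theta_1},\dots,p_n=p_{\theta_n}$ be linearly independent densities with $\theta_1,\dots,\theta_n\in\Theta$, and let $w\in\mathbb{R}_+^n$ with $\sum_{i=1}^n w_i=1$. Then for every integer $\alpha\ge 2$, the Minkowski diversity index $$J^M_\alpha(p_1,\dots,p_n;w_1,\dots,w_n)=\sum_{i=1}^n w_i\|p_i\|_\alpha-\left\|\sum_{i=1}^n w_ip_i\right\|_\alpha$$ is finite and admits a closed-form formula.
   Context: Setting: $(\mathcal{X},\mathcal{F})$ is a measurable space with a nonzero positive measure $\mu$. For measurable $f:\mathcal{X}\to\mathbb{R}$ and $\alpha\ge 1$, $\|f\|_\alpha=\left(\int_{\mathcal{X}}|f|^\alpha\,\mathrm{d}\mu\right)^{1/\alpha}$ is the norm of $L_\alpha(\mu)$. Exponential family: given a measurable map $t:\mathcal{X}\to\mathbb{R}^D$ (sufficient statistics), the natural parameter space is $\Theta=\{\theta\in\mathbb{R}^D:\int_{\mathcal{X}}\exp(t(x)^\top\theta)\,\mathrm{d}\mu(x)<\infty\}$, the log-partition function is $F(\theta)=\log\int_{\mathcal{X}}\exp(t(x)^\top\theta)\,\mathrm{d}\mu(x)$ for $\theta\in\Theta$, and $\mathcal{E}_{t,\mu}=\{p_\theta:\theta\in\Theta\}$ with $p_\theta(x)=\exp(t(x)^\top\theta-F(\theta))$. It is called a conic exponential family (CEF) if $\Theta$ is a cone, i.e.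 $\lambda\theta\in\Theta$ for all $\theta\in\Theta$ and $\lambda>0$. Meaning of closed form: a basic sum is an expression $$\sum_{a\in\mathbb{N}^n,\ a_1+\dots+a_n=\alpha} c_a\left(\prod_{i=1}^n w_i^{a_i}\right)\exp\left(F\Big(\sum_{i=1}^n a_i\theta_i\Big)-\sum_{i=1}^n a_iF(\theta_i)\right)$$ where $\mathbb{N}=\{0,1,2,\dots\}$, $0^0=1$, and the $c_a$ are explicit integers depending only on $\alpha,n,a$; basic sums with the weights replaced by constants $0$ or $1$ are also allowed. A quantity admits a closed-form formula if it is given by an explicit finite expression, of a shape depending only on $\alpha,n$, built from basic sums and the weights $w_i$ by additions, subtractions, multiplications, divisions, $\alpha$-th roots and logarithms. *)

(* Defs.v *)
From HB Require Import structures.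
From mathcomp Require Import all_boot all_order all_algebra.
From mathcomp Require Import all_classical all_reals all_analysis.

Set Implicit Arguments.
Unset Strict Implicit.
Unset Printing Implicit Defensive.

Import Order.TTheory GRing.Theory Num.Theory.
Import numFieldNormedType.Exports.

Local Open Scope classical_set_scope.
Local Open Scope ring_scope.

Definition dotp (R : realType) (D : nat) (u v : 'cV[R]_D) : R :=
  (u^T *m v) 0 0.

Definition partition_function d (T : measurableType d) (R : realType)
    (mu : {measure set T -> \bar R}) (D : nat) (t : T -> 'cV[R]_D)
    (theta : 'cV[R]_D) : \bar R :=
  (\int[mu]_x (expR (dotp (t x) theta))%:E)%E.

Definition natural_space d (T : measurableType d) (R : realType)
    (mu : {measure set T -> \bar R}) (D : nat) (t : T -> 'cV[R]_D) :
    set 'cV[R]_D :=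
  [set theta | (partition_function mu t theta < +oo)%E].

(* Meaningful on the natural parameter space only: [fine] sends +oo to 0. *)
Definition log_partition d (T : measurableType d) (R : realType)
    (mu : {measure set T -> \bar R}) (D : nat) (t : T -> 'cV[R]_D)
    (theta : 'cV[R]_D) : R :=
  ln (fine (partition_function mu t theta)).

Definition density d (T : measurableType d) (R : realType)
    (mu : {measure set T -> \bar R}) (D : nat) (t : T -> 'cV[R]_D)
    (theta : 'cV[R]_D) (x : T) : R :=
  expR (dotp (t x) theta - log_partition mu t theta).

(* The library has no sigma-algebra on column vectors; a map to R^D is Borel
   measurable iff its coordinates are. *)
Definition measurable_vector_fun d (T : measurableType d) (R : realType)
    (D : nat) (t : T -> 'cV[R]_D) : Prop :=
  forall j : 'I_D, measurable_fun [set: T] (fun x => t x j 0).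

Definition is_cone (R : realType) (D : nat) (A : set 'cV[R]_D) : Prop :=
  forall (theta : 'cV[R]_D) (lambda : R),
    A theta -> 0 < lambda -> A (lambda *: theta).

Definition conic_exponential_family d (T : measurableType d) (R : realType)
    (mu : {measure set T -> \bar R}) (D : nat) (t : T -> 'cV[R]_D) : Prop :=
  measurable_vector_fun t /\ is_cone (natural_space mu t).

(* Independence in the space of functions T -> R; it is implied by independence
   of the classes modulo mu-almost everywhere equality. *)
Definition linearly_independent (R : realType) (T : Type) (n : nat)
    (p : 'I_n -> T -> R) : Prop :=
  forall c : 'I_n -> R,
    (forall x, \sum_(i < n) c i * p i x = 0) -> forall i, c i = 0.

Definition minkowski_diversity d (T : measurableType d) (R : realType)
    (mu : {measure set T -> \bar R}) (alpha : R) (n : nat)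
    (p : 'I_n -> T -> R) (w : 'I_n -> R) : \bar R :=
  (\sum_(i < n) (w i)%:E * 'N[mu]_(alpha%:E)[EFin \o p i]
   - 'N[mu]_(alpha%:E)[EFin \o (fun x => \sum_(i < n) w i * p i x)%R])%E.

(* A multi-index a in N^n with a_1 + ... + a_n = alpha has all its entries at
   most alpha, hence is an element of this finite type satisfying [mi_deg]. *)
Definition multi_index (alpha n : nat) := {ffun 'I_n -> 'I_alpha.+1}.

Definition mi_deg (alpha n : nat) (a : multi_index alpha n) : bool :=
  (\sum_(i < n) (a i : nat))%N == alpha.

Definition mi_comb (R : realType) (alpha n D : nat) (a : multi_index alpha n)
    (theta : 'I_n -> 'cV[R]_D) : 'cV[R]_D :=
  \sum_(i < n) (a i)%:R *: theta i.

Definition basic_sum (R : realType) (alpha n D : nat) (F : 'cV[R]_D -> R)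
    (theta : 'I_n -> 'cV[R]_D) (c : multi_index alpha n -> int)
    (v : 'I_n -> R) : R :=
  \sum_(a : multi_index alpha n | mi_deg a)
    (c a)%:~R * (\prod_(i < n) v i ^+ a i)
    * expR (F (mi_comb a theta) - \sum_(i < n) (a i)%:R * F (theta i)).

(* Only the integers c_a, the 0/1 constants and the tree itself are stored, so
   an expression cannot depend on the family, the parameters or the weights. *)
Inductive cf_expr (alpha n : nat) : Type :=
  | CFBasic of (multi_index alpha n -> int)
  | CFBasicCst of (multi_index alpha n -> int) & ('I_n -> bool)
  | CFWeight of 'I_n
  | CFAdd of cf_expr alpha n & cf_expr alpha n
  | CFSub of cf_expr alpha n & cf_expr alpha n
  | CFMul of cf_expr alpha n & cf_expr alpha n
  | CFDiv of cf_expr alpha n & cf_expr alpha n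
  | CFRoot of cf_expr alpha n
  | CFLog of cf_expr alpha n.

Fixpoint cf_eval (R : realType) (alpha n D : nat) (F : 'cV[R]_D -> R)
    (theta : 'I_n -> 'cV[R]_D) (w : 'I_n -> R) (e : cf_expr alpha n) : R :=
  match e with
  | CFBasic c => basic_sum F theta c w
  | CFBasicCst c b => basic_sum F theta c (fun i => (b i)%:R)
  | CFWeight i => w i
  | CFAdd e1 e2 => cf_eval F theta w e1 + cf_eval F theta w e2
  | CFSub e1 e2 => cf_eval F theta w e1 - cf_eval F theta w e2
  | CFMul e1 e2 => cf_eval F theta w e1 * cf_eval F theta w e2
  | CFDiv e1 e2 => cf_eval F theta w e1 / cf_eval F theta w e2
  | CFRoot e1 => cf_eval F theta w e1 `^ (alpha%:R)^-1
  | CFLog e1 => ln (cf_eval F theta w e1)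
  end.

(* Rules out the default values of the total functions above: F is only
   evaluated on Theta, and divisions, roots and logarithms are genuine. *)
Fixpoint cf_defined (R : realType) (alpha n D : nat) (Theta : set 'cV[R]_D)
    (F : 'cV[R]_D -> R) (theta : 'I_n -> 'cV[R]_D) (w : 'I_n -> R)
    (e : cf_expr alpha n) : Prop :=
  match e with
  | CFBasic _ | CFBasicCst _ _ =>
      (forall i, Theta (theta i)) /\
      (forall a : multi_index alpha n, mi_deg a -> Theta (mi_comb a theta))
  | CFWeight _ => True
  | CFAdd e1 e2 | CFSub e1 e2 | CFMul e1 e2 =>
      cf_defined Theta F theta w e1 /\ cf_defined Theta F theta w e2
  | CFDiv e1 e2 =>
      [/\ cf_defined Theta F theta w e1, cf_defined Theta F theta w e2
        & cf_eval F theta w e2 != 0]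
  | CFRoot e1 => cf_defined Theta F theta w e1 /\ 0 <= cf_eval F theta w e1
  | CFLog e1 => cf_defined Theta F theta w e1 /\ 0 < cf_eval F theta w e1
  end.

(* Main.v *)
(** Expanding the [alpha]-th power of [\sum_i v i * p_i] over words of length
    [alpha] and grouping words by letter counts gives monomials
    [\prod_i p_i ^+ a i], and each of them is, up to the factor
    [expR (- \sum_i a i * F (theta i))], the unnormalised density at
    [\sum_i a i *: theta i].  Its integral is finite because
    [\prod_i y_i ^+ a i <= \sum_i y_i ^+ alpha] for nonnegative [y_i], and
    [alpha *: theta i] lies in the natural parameter space, which is a cone.
    Hence [\int (\sum_i v i * p_i) ^+ alpha] is a basic sum; the weights [w]
    give the norm of the mixture, and the 0/1 indicator of [i] that of [p_i]. *)
Require Import Defs.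
From HB Require Import structures.
From mathcomp Require Import all_boot all_order all_algebra.
From mathcomp Require Import all_classical all_reals all_analysis.
From mathcomp Require Import measurable_realfun.
Set Implicit Arguments.
Unset Strict Implicit.
Unset Printing Implicit Defensive.

Import Order.TTheory GRing.Theory Num.Theory.
Import numFieldNormedType.Exports.
Local Open Scope classical_set_scope.
Local Open Scope ring_scope.

(** [inord] never falls back on its default value: a letter occurs at most [alpha] times in a word
    of length [alpha]. *)
Definition letter_counts (alpha n : nat) (f : {ffun 'I_alpha -> 'I_n}) :
  multi_index alpha n := [ffun i => inord #|[pred j | f j == i]|].

(* The multinomial coefficient [alpha! / \prod_i (a i)!]. *)
Definition word_count (alpha n : nat) (a : multi_index alpha n) : nat :=
  #|[pred f : {ffun 'I_alpha -> 'I_n} | letter_counts f == a]|.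

Lemma letter_countsE (alpha n : nat) (f : {ffun 'I_alpha -> 'I_n}) (i : 'I_n) :
  letter_counts f i = #|[pred j | f j == i]| :> nat.
Proof. by rewrite ffunE inordK// ltnS -[leqRHS]card_ord max_card. Qed.

Lemma mi_deg_letter_counts (alpha n : nat) (f : {ffun 'I_alpha -> 'I_n}) :
  mi_deg (letter_counts f).
Proof.
rewrite /mi_deg -[eqbRHS]card_ord -sum1_card (partition_big f predT)//=.
by under eq_bigr do rewrite letter_countsE -sum1_card.
Qed.

Lemma prod_letter_counts (R : comNzRingType) (alpha n : nat)
    (f : {ffun 'I_alpha -> 'I_n}) (v : 'I_n -> R) :
  \prod_j v (f j) = \prod_i v i ^+ letter_counts f i.
Proof.
rewrite (partition_big f predT)//=; apply: eq_bigr => i _.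
rewrite letter_countsE -prodr_const.
by apply: eq_big => [j//|j /eqP ->].
Qed.

Lemma expr_sum_multi_index (R : comNzRingType) (alpha n : nat) (v : 'I_n -> R) :
  (\sum_(i < n) v i) ^+ alpha =
  \sum_(a : multi_index alpha n | mi_deg a)
    (word_count a)%:R * \prod_i v i ^+ a i.
Proof.
(* The power, seen as a product over ['I_alpha], distributes into one term per word. *)
rewrite -[X in _ ^+ X]card_ord -prodr_const bigA_distr_bigA/=.
rewrite (partition_big (@letter_counts alpha n) (@mi_deg alpha n))/=; last first.
  by move=> f _; exact: mi_deg_letter_counts.
apply: eq_bigr => a _; rewrite mulr_natl -sumr_const.
by apply: eq_big => // f /eqP <-; exact: prod_letter_counts.
Qed.

(** Each factor is at most the largest entry [y k]; as the exponents add up to [alpha], the product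
    is at most [y k ^+ alpha], itself one of the summands. *)
Lemma prod_exp_le_sum (R : realDomainType) (alpha n : nat)
    (a : multi_index alpha n) (y : 'I_n -> R) :
  (0 < alpha)%N -> mi_deg a -> (forall i, 0 <= y i) ->
  \prod_i y i ^+ a i <= \sum_i y i ^+ alpha.
Proof.
move=> alpha_gt0 /eqP dega y0.
(* The maximum needs a nonempty index set; an empty one would force [alpha = 0]. *)
have [i0 _] : exists i : 'I_n, true.
  case: n a y dega y0 => [|n] a y dega _; last by exists ord0.
  by move: alpha_gt0; rewrite -dega big_ord0.
pose k := [arg max_(i > i0) y i]%O.
have yk i : y i <= y k by rewrite /k; case: arg_maxP => // j _; apply.
apply: (@le_trans _ _ (y k ^+ alpha)).
  rewrite -[in leRHS]dega -prodrXr; apply: ler_prod => i _.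
  by rewrite exprn_ge0//= lerXn2r// nnegrE.
by rewrite (bigD1 k)//= lerDl; apply: sumr_ge0 => i _; rewrite exprn_ge0.
Qed.

Section exponential_family.
Context {R : realType} {d : measure_display} {T : measurableType d}.
Variables (mu : {measure set T -> \bar R}) (D : nat) (t : T -> 'cV[R]_D).
Hypothesis mt : measurable_vector_fun t.
Local Notation Theta := (natural_space mu t).
Local Notation Z := (partition_function mu t).
Local Notation F := (log_partition mu t).

Lemma dotp_sumr (n : nat) (u : 'cV[R]_D) (c : 'I_n -> R)
    (theta : 'I_n -> 'cV[R]_D) :
  dotp u (\sum_i c i *: theta i) = \sum_i c i * dotp u (theta i).
Proof.
rewrite /dotp mulmx_sumr summxE; apply: eq_bigr => i _.
by rewrite -scalemxAr mxE.
Qed.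

Lemma measurable_dotp (theta : 'cV[R]_D) :
  measurable_fun [set: T] (fun x => dotp (t x) theta).
Proof.
under eq_fun do rewrite /dotp mxE.
apply: measurable_sum => j; under eq_fun do rewrite mxE.
by apply: measurable_funM => //; exact: mt.
Qed.

Lemma measurable_expR_dotp (theta : 'cV[R]_D) :
  measurable_fun [set: T] (fun x => (expR (dotp (t x) theta))%:E).
Proof.
apply/measurable_EFinP; apply: (measurableT_comp (@measurable_expR R)).
exact: measurable_dotp.
Qed.

(** The integrand is positive everywhere, so if its integral were zero the whole space would be a
    null set. *)
Lemma partition_function_gt0 (theta : 'cV[R]_D) :
  mu [set: T] != 0%E -> (0 < Z theta)%E.
Proof.
move=> mu0; rewrite lt0e integral_ge0 ?andbT; last first.
  by move=> x _; rewrite lee_fin expR_ge0.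
apply: contra mu0 => /eqP Z0; apply/eqP.
have /ae_eq_integral_abs : measurable_fun [set: T]
  (fun x => (expR (dotp (t x) theta))%:E) by exact: measurable_expR_dotp.
move=> /(_ mu measurableT) [+ _].
have -> : (\int[mu]_x `|(expR (dotp (t x) theta))%:E| = 0)%E.
  by rewrite -Z0; apply: eq_integral => x _; rewrite gee0_abs// lee_fin expR_ge0.
move=> /(_ erefl) [N [mN N0 sN]].
apply: (subset_measure0 measurableT mN _ N0) => x _; apply: sN => /= /(_ I).
by case=> /eqP; rewrite gt_eqF// expR_gt0.
Qed.

(** On the natural space the partition function is finite and positive, so neither [fine] nor [ln]
    returns a default value. *)
Lemma expR_log_partition (theta : 'cV[R]_D) :
  mu [set: T] != 0%E -> Theta theta -> (expR (F theta))%:E = Z theta.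
Proof.
move=> mu0 Ztheta; have Z0 := partition_function_gt0 theta mu0.
have Zfin : Z theta \is a fin_num by rewrite ge0_fin_numE// ltW.
by rewrite lnK ?fineK// posrE fine_gt0// Z0.
Qed.

Lemma mi_comb_natural_space (alpha n : nat) (a : multi_index alpha n)
    (theta : 'I_n -> 'cV[R]_D) :
  (0 < alpha)%N -> mi_deg a -> is_cone Theta ->
  (forall i, Theta (theta i)) -> Theta (mi_comb a theta).
Proof.
move=> alpha_gt0 dega cone Htheta.
apply: (@le_lt_trans _ _ (\sum_i Z (alpha%:R *: theta i))%E); last first.
  by apply: lte_sum_pinfty => i _; apply: cone => //; rewrite ltr0n.
rewrite -ge0_integral_sum//=; last by move=> i; exact: measurable_expR_dotp.
apply: ge0_le_integral => //.
- exact: measurable_expR_dotp.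
- by apply: emeasurable_sum => i; exact: measurable_expR_dotp.
(* Pointwise this is [prod_exp_le_sum] with [y i = expR (dotp (t x) (theta i))]. *)
move=> x _; rewrite sumEFin lee_fin dotp_sumr expR_sum.
under eq_bigr do rewrite expRM_natl.
under [leRHS]eq_bigr do rewrite /dotp -scalemxAr mxE expRM_natl.
by apply: prod_exp_le_sum => // i; exact: expR_ge0.
Qed.

Lemma prod_density (alpha n : nat) (a : multi_index alpha n)
    (theta : 'I_n -> 'cV[R]_D) (x : T) :
  \prod_i density mu t (theta i) x ^+ a i =
  expR (- \sum_i (a i)%:R * F (theta i)) * expR (dotp (t x) (mi_comb a theta)).
Proof.
rewrite -expRD dotp_sumr addrC -sumrB expR_sum; apply: eq_bigr => i _.
by rewrite -mulrBr expRM_natl.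
Qed.

Lemma integral_mixture_exp (alpha n : nat) (theta : 'I_n -> 'cV[R]_D)
    (v : 'I_n -> R) :
  (0 < alpha)%N -> mu [set: T] != 0%E -> is_cone Theta ->
  (forall i, Theta (theta i)) -> (forall i, 0 <= v i) ->
  (\int[mu]_x ((\sum_i v i * density mu t (theta i) x) ^+ alpha)%:E)%E =
  (basic_sum F theta (fun a : multi_index alpha n => Posz (word_count a)) v)%:E.
Proof.
move=> alpha_gt0 mu0 cone Htheta v0.
(* [k a] gathers the factors that do not depend on [x]; being nonnegative, it can leave the integral
   before finiteness is known. *)
pose k (a : multi_index alpha n) : R := (word_count a)%:R *
  (\prod_i v i ^+ a i) * expR (- \sum_i (a i)%:R * F (theta i)).
have k0 a : 0 <= k a.
  by rewrite !mulr_ge0 ?expR_ge0// prodr_ge0// => i _; rewrite exprn_ge0.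
transitivity (\int[mu]_x \sum_(a | mi_deg a)
    ((k a)%:E * (expR (dotp (t x) (mi_comb a theta)))%:E))%E.
  apply: eq_integral => x _; rewrite expr_sum_multi_index -sumEFin.
  apply: eq_bigr => a _; under eq_bigr do rewrite exprMn.
  by rewrite big_split/= prod_density -EFinM !mulrA.
under eq_integral do rewrite -big_filter.
rewrite ge0_integral_sum//=; last 2 first.
- by move=> a; apply: measurable_funeM; exact: measurable_expR_dotp.
- by move=> a x _; rewrite -EFinM lee_fin mulr_ge0// expR_ge0.
rewrite big_filter /basic_sum -sumEFin; apply: eq_bigr => a dega.
rewrite ge0_integralZl_EFin//; last exact: measurable_expR_dotp.
(* Finiteness enters here: the partition function at [mi_comb a theta] becomes the exponential of
   [F]. *)
rewrite -[X in (_ * X)%E]/(Z (mi_comb a theta)) -expR_log_partition//; last first.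
  exact: mi_comb_natural_space.
by rewrite -EFinM -[X in X%:E]mulrA -expRD [- _ + _]addrC.
Qed.

(** The weights need not sum to 1, so indicator weights are allowed. The bound [0 <= b] provides the
    side condition of [CFRoot]. *)
Lemma Lnorm_mixture (alpha n : nat) (theta : 'I_n -> 'cV[R]_D)
    (v : 'I_n -> R) :
  (0 < alpha)%N -> mu [set: T] != 0%E -> is_cone Theta ->
  (forall i, Theta (theta i)) -> (forall i, 0 <= v i) ->
  let b := basic_sum F theta
    (fun a : multi_index alpha n => Posz (word_count a)) v in
  0 <= b /\
  'N[mu]_((alpha%:R)%:E)[EFin \o
     (fun x => \sum_i v i * density mu t (theta i) x)%R]%E =
  (b `^ (alpha%:R)^-1)%:E.
Proof.
move=> alpha_gt0 mu0 cone Htheta v0 b.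
have mix0 x : 0 <= \sum_i v i * density mu t (theta i) x.
  by apply: sumr_ge0 => i _; rewrite mulr_ge0// expR_ge0.
have intE := integral_mixture_exp alpha_gt0 mu0 cone Htheta v0.
split.
  by rewrite -lee_fin -intE; apply: integral_ge0 => x _; rewrite lee_fin exprn_ge0.
rewrite unlock -poweR_EFin -intE; congr (_ `^ _)%E; apply: eq_integral => x _ /=.
by rewrite ger0_norm// powR_mulrn.
Qed.

Lemma Lnorm_density (alpha n : nat) (theta : 'I_n -> 'cV[R]_D) (i : 'I_n) :
  (0 < alpha)%N -> mu [set: T] != 0%E -> is_cone Theta ->
  (forall i, Theta (theta i)) ->
  let b := basic_sum F theta
    (fun a : multi_index alpha n => Posz (word_count a))
    (fun j => (j == i)%:R) in
  0 <= b /\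
  'N[mu]_((alpha%:R)%:E)[EFin \o density mu t (theta i)]%E =
  (b `^ (alpha%:R)^-1)%:E.
Proof.
move=> alpha_gt0 mu0 cone Htheta b.
have [b0 <-] := Lnorm_mixture alpha_gt0 mu0 cone Htheta
  (fun j => ler0n R (j == i)).
split=> //; apply: eq_Lnorm => x /=; congr (_%:E).
rewrite (bigD1 i)//= eqxx mul1r big1 ?addr0// => j /negbTE ->.
by rewrite mul0r.
Qed.

End exponential_family.

(* [cf_expr] has no constants: an all-zero basic sum plays the role of 0. *)
Definition cf_sum (alpha n : nat) (s : seq 'I_n)
    (g : 'I_n -> cf_expr alpha n) : cf_expr alpha n :=
  foldr (fun i e => CFAdd (g i) e) (CFBasic (fun=> 0)) s.

Lemma cf_eval_sum (R : realType) (alpha n D : nat) (F : 'cV[R]_D -> R)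
    (theta : 'I_n -> 'cV[R]_D) (w : 'I_n -> R) (s : seq 'I_n)
    (g : 'I_n -> cf_expr alpha n) :
  cf_eval F theta w (cf_sum s g) = \sum_(i <- s) cf_eval F theta w (g i).
Proof.
elim: s => [|i s /= ->]; last by rewrite big_cons.
by rewrite big_nil /= /basic_sum big1// => a _; rewrite !mul0r.
Qed.

Lemma cf_defined_sum (R : realType) (alpha n D : nat) (Theta : set 'cV[R]_D)
    (F : 'cV[R]_D -> R) (theta : 'I_n -> 'cV[R]_D) (w : 'I_n -> R)
    (s : seq 'I_n) (g : 'I_n -> cf_expr alpha n) :
  (forall i, Theta (theta i)) ->
  (forall a : multi_index alpha n, mi_deg a -> Theta (mi_comb a theta)) ->
  (forall i, cf_defined Theta F theta w (g i)) ->
  cf_defined Theta F theta w (cf_sum s g).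
Proof. by move=> Htheta Hcomb Hg; elim: s. Qed.

Unset Implicit Arguments.

Theorem corollary9 (alpha n : nat) (halpha : (2 <= alpha)%N) (hn : (1 <= n)%N) :
  exists e : cf_expr alpha n,
  forall (R : realType) (d : measure_display) (T : measurableType d)
    (mu : {measure set T -> \bar R}) (D : nat) (t : T -> 'cV[R]_D)
    (theta : 'I_n -> 'cV[R]_D) (w : 'I_n -> R),
    mu [set: T] != 0%E ->
    conic_exponential_family mu t ->
    (forall i, natural_space mu t (theta i)) ->
    linearly_independent (fun i => density mu t (theta i)) ->
    (forall i, 0 <= w i) ->
    \sum_(i < n) w i = 1 ->
    let F := log_partition mu t in
    let J := minkowski_diversity mu (alpha%:R : R)
               (fun i => density mu t (theta i)) w in
    [/\ J \is a fin_num,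
        cf_defined (natural_space mu t) F theta w e
      & J = (cf_eval F theta w e)%:E].
Proof.
(* The witness mirrors the definition of the index and is fixed before the family, the parameters
   and the weights are introduced. *)
pose c (a : multi_index alpha n) := Posz (word_count a).
pose norm_p i := CFRoot (CFBasicCst c (fun j => j == i)).
exists (CFSub (cf_sum (enum 'I_n) (fun i => CFMul (CFWeight alpha i) (norm_p i)))
              (CFRoot (CFBasic c))).
move=> R d T mu D t theta w mu0 [mt cone] Htheta _ w0 _ F J.
have alpha_gt0 : (0 < alpha)%N by exact: ltnW.
have Hcomb (a : multi_index alpha n) : mi_deg a ->
    natural_space mu t (mi_comb a theta).
  by move=> dega; exact: mi_comb_natural_space.
have Np i := Lnorm_density mt i alpha_gt0 mu0 cone Htheta.
have [mix0 Nmix] :=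
  Lnorm_mixture mt alpha_gt0 mu0 cone Htheta w0.
set e := CFSub _ _.
have JE : J = (cf_eval F theta w e)%:E.
  rewrite /J /minkowski_diversity Nmix /= cf_eval_sum big_enum/=.
  under eq_bigr do rewrite (Np _).2 -EFinM.
  by rewrite sumEFin -EFinB.
(* Finiteness follows from equality with a real number; definedness then only requires the radicands
   to be nonnegative and [F] to be evaluated on the natural space. *)
split=> //; first by rewrite JE.
split; last by split.
by apply: cf_defined_sum => // i; split=> //; split=> //; exact: (Np i).1.
Qed.
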